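(* Let $G$ be a finite simple $2$-connected graph that is factor-critical and equimatchable. Let $v$ be a vertex of $G$ and let $M_v$ be a minimal matching isolating $v$. Then $G\setminus(V(M_v)\cup\{v\})$ is isomorphic to $K_{2n}$ or to $K_{n,n}$ for some nonnegative integer $n$.
   Context: A matching is a set of pairwise disjoint edges; $V(M)$ denotes the set of vertices incident with edges of $M$. A graph $G$ is factor-critical if $G-w$ has a perfect matching for every vertex $w$. $G$ is equimatchable if every maximal matching of $G$ is a maximum matching. A matching $M$ isolates a vertex $v$ if $\{v\}$ is a connected component of $G\setminus V(M)$; such an $M$ is minimal if no proper subset of $M$ isolates $v$. *)

(* Defs.v *)
From mathcomp Require Import all_boot.

Set Implicit Arguments.
Unset Strict Implicit.
Unset Printing Implicit Defensive.

Record sgraph := SGraph {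
  vertex :> finType;
  adj : rel vertex;
  adj_sym : symmetric adj;
  adj_irrefl : irreflexive adj }.

Section Induced.
Variables (G : sgraph) (A : {set G}).

Definition induced_adj : rel {x : G | x \in A} :=
  fun x y => adj (val x) (val y).

Fact induced_adj_sym : symmetric induced_adj.
Proof. by move=> x y; apply: adj_sym. Qed.

Fact induced_adj_irrefl : irreflexive induced_adj.
Proof. by move=> x; apply: adj_irrefl. Qed.

Definition induced : sgraph := SGraph induced_adj_sym induced_adj_irrefl.
End Induced.

Definition del_vertices (G : sgraph) (A : {set G}) : sgraph := induced (~: A).

Definition complete_adj (n : nat) : rel 'I_n := fun x y => x != y.

Fact complete_adj_sym n : symmetric (@complete_adj n).
Proof. by move=> x y; rewrite /complete_adj eq_sym. Qed.

Fact complete_adj_irrefl n : irreflexive (@complete_adj n).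
Proof. by move=> x; rewrite /complete_adj eqxx. Qed.

Definition complete_graph (n : nat) : sgraph :=
  SGraph (@complete_adj_sym n) (@complete_adj_irrefl n).

Definition complete_bipartite_adj (m n : nat) : rel ('I_m + 'I_n) :=
  fun x y => match x, y with
             | inl _, inr _ | inr _, inl _ => true
             | _, _ => false
             end.

Fact complete_bipartite_adj_sym m n : symmetric (@complete_bipartite_adj m n).
Proof. by move=> [x|x] [y|y]. Qed.

Fact complete_bipartite_adj_irrefl m n :
  irreflexive (@complete_bipartite_adj m n).
Proof. by move=> [x|x]. Qed.

Definition complete_bipartite (m n : nat) : sgraph :=
  SGraph (@complete_bipartite_adj_sym m n) (@complete_bipartite_adj_irrefl m n).

Definition isomorphic (G H : sgraph) : Prop :=
  exists2 f : G -> H, bijective f & {mono f : x y / adj x y}.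

Definition components (G : sgraph) : {set {set G}} :=
  equivalence_partition (connect (@adj G)) [set: G].

(* The graph with no vertex is connected under this definition, which is
   harmless in [k_connected], where at least one vertex always remains. *)
Definition connected (G : sgraph) : Prop :=
  forall x y : G, connect (@adj G) x y.

Definition k_connected (k : nat) (G : sgraph) : Prop :=
  k < #|G| /\
  forall A : {set G}, #|A| < k -> connected (del_vertices A).

Definition edges (G : sgraph) : {set {set G}} :=
  [set [set x; y] | x in [set: G], y in [set: G] & adj x y].

Definition matching (G : sgraph) (M : {set {set G}}) : bool :=
  (M \subset edges G) && trivIset M.

Definition perfect_matching (G : sgraph) (M : {set {set G}}) : bool :=
  matching M && (cover M == [set: G]).

Definition maximum_matching (G : sgraph) (M : {set {set G}}) : Prop :=
  matching M /\ forall N : {set {set G}}, matching N -> #|N| <= #|M|.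

Definition factor_critical (G : sgraph) : Prop :=
  forall w : G, exists M : {set {set del_vertices [set w]}},
    perfect_matching M.

Definition equimatchable (G : sgraph) : Prop :=
  forall M : {set {set G}},
    maxset (@matching G) M -> maximum_matching M.

(* [cover M] is V(M).  Components of the graph with V(M) deleted are sets over
   a subtype of [G], hence the image under [val]. *)
Definition isolates (G : sgraph) (M : {set {set G}}) (v : G) : Prop :=
  exists2 C : {set del_vertices (cover M)},
    C \in components (del_vertices (cover M)) & val @: C = [set v].

Definition minimal_isolating_matching
    (G : sgraph) (M : {set {set G}}) (v : G) : Prop :=
  [/\ matching M, isolates M v
    & forall N : {set {set G}}, N \proper M -> ~ isolates N v].

(* Main.v *)
Require Import Defs.
From mathcomp Require Import all_boot.

(* Let H be G without V(M) and v. Since a maximal matching of G misses exactly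
   one vertex, no matching can leave behind two odd sets each without neighbours
   in the rest. With M and v itself this forces every maximal matching of H to be
   perfect. By exchanging edges, every path abcd of such a graph closes up to a
   4-cycle, so if H is connected it is complete (if it has a triangle) or complete
   bipartite.

   If H had two components, consider the edges of M attached to them. Replacing
   an edge zw of M by zc, with c in a component C, leaves the odd set C - c, and
   doing so at two edges attached to different components shows that both ends of
   each such edge are attached to its component and that nothing leads from there
   to the other component except through v. So v would be a cut vertex. Otherwise
   all the components are attached to a single edge of M, in fact to a single
   vertex of V(M), which would be a cut vertex. *)

Set Implicit Arguments.
Unset Strict Implicit.
Unset Printing Implicit Defensive.

(** * Matchings and the vertex sets they cover *)

Section Matchings.
Variable G : sgraph.
Implicit Types (x y u : G) (W S : {set G}) (N : {set {set G}}).

Lemma adj_neq x y : adj x y -> x != y.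
Proof. by apply: contraTneq => ->; rewrite adj_irrefl. Qed.

Lemma edgesP (e : {set G}) :
  reflect (exists x y, adj x y /\ e = [set x; y]) (e \in edges G).
Proof.
apply: (iffP imset2P) => [[x y _]|[x [y [xy ->]]]].
  by rewrite !inE /= => xy ->; exists x, y.
by exists x y; rewrite ?inE.
Qed.

Lemma mem_edges x y : ([set x; y] \in edges G) = adj x y.
Proof.
apply/edgesP/idP => [[a [b [ab /setP E]]]|xy]; last by exists x, y.
move: (E a) (E b) (E x) (E y) (adj_neq ab); rewrite !inE !eqxx ?orbT /=.
do 2 case/orP=> /eqP ?; subst => //; rewrite ?eqxx ?orbT //=.
by rewrite adj_sym.
Qed.

Lemma matching_edge N e : matching N -> e \in N -> e \in edges G.
Proof. by case/andP=> /subsetP sN _ /sN. Qed.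

Lemma card_cover_matching N : matching N -> #|cover N| = 2 * #|N|.
Proof.
move=> mN; have /andP[_ tN] := mN; move: (tN) => /eqP <-.
rewrite (eq_bigr (fun=> 2)) ?sum_nat_const ?[2 * _]mulnC // => e eN.
have /edgesP[x [y [xy ->]]] := matching_edge mN eN.
by rewrite cards2 (adj_neq xy).
Qed.

Lemma matchingS N N' : N' \subset N -> matching N -> matching N'.
Proof.
move=> sN /andP[eN tN]; rewrite /matching (subset_trans sN eN).
exact: trivIsetS sN tN.
Qed.

Lemma cover_matchingD N N' : matching N -> N' \subset N ->
  cover (N :\: N') = cover N :\: cover N'.
Proof.
move=> /andP[_ tN] sN; apply/setP=> x; rewrite inE.
apply/bigcupP/andP => [[e /setDP[eN eN'] xe]|[xN' /bigcupP[e eN xe]]].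
  split; last by apply/bigcupP; exists e.
  apply: contra eN' => /bigcupP[e' e'N' xe'].
  have e'N := subsetP sN _ e'N'.
  by rewrite -(def_pblock tN eN xe) (def_pblock tN e'N xe').
exists e => //; rewrite inE eN andbT; apply: contra xN' => eN'.
by apply/bigcupP; exists e.
Qed.

(** [W] is exactly the vertex set of a matching. Exchanging edges then becomes an identity between
    vertex sets, and the matching itself need not be named. *)
Definition matchable W := exists2 N, matching N & cover N = W.

Lemma matchable_cover N : matching N -> matchable (cover N).
Proof. by exists N. Qed.

Lemma matchable0 : matchable set0.
Proof.
exists set0; last by rewrite /cover big_set0.
by rewrite /matching sub0set; apply/trivIsetP=> ? ?; rewrite inE.
Qed.

Lemma matchable_disjointU W W' : [disjoint W & W'] ->
  matchable W -> matchable W' -> matchable (W :|: W').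
Proof.
move=> dW [N /andP[eN tN] cN] [N' /andP[eN' tN'] cN'].
exists (N :|: N'); last by rewrite /cover bigcup_setU -cN -cN'.
rewrite /matching subUset eN eN' /=; apply: trivIsetU => //.
by rewrite cN cN'.
Qed.

Lemma matchable_pair x y : adj x y -> matchable [set x; y].
Proof.
move=> xy; exists [set [set x; y]]; last exact: cover1.
by rewrite /matching sub1set mem_edges xy trivIset1.
Qed.

Lemma matchable_add x y W : adj x y -> x \notin W -> y \notin W ->
  matchable W -> matchable ([set x; y] :|: W).
Proof.
move=> xy xW yW mW; apply: matchable_disjointU => //; last exact: matchable_pair.
by rewrite disjoints_subset subUset !sub1set !inE xW.
Qed.

Lemma matchable_eq W W' : W =i W' -> matchable W -> matchable W'.
Proof. by move/setP->. Qed.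

(** Otherwise the edge xy could be added to [N]. *)
Lemma maximal_matching_neighbor N x y : maxset (@matching G) N ->
  x \notin cover N -> adj x y -> y \in cover N.
Proof.
move=> mN xN xy; apply: contraT => yN.
have /andP[eN tN] := maxsetp mN.
suff /(maxsetsup mN) : matching ([set x; y] |: N).
  move/(_ (subsetUr _ _)) => E; case/negP: xN.
  by apply/bigcupP; exists [set x; y]; [rewrite -E|]; rewrite !inE eqxx.
rewrite /matching subUset sub1set mem_edges xy eN /= trivIsetU ?trivIset1 //.
by rewrite cover1 disjoints_subset subUset !sub1set !inE xN.
Qed.

End Matchings.

(** * Matchings of an induced subgraph seen in the whole graph *)

Section Lift.
Variables (G : sgraph) (A : {set G}).

Lemma lift_matching (N : {set {set induced A}}) : matching N ->
  matching [set val @: e | e : {set induced A} in N].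
Proof.
move=> mN; have /andP[eN tN] := mN.
apply/andP; split.
  apply/subsetP=> _ /imsetP[e eN' ->].
  have /edgesP[x [y [xy ->]]] := matching_edge mN eN'.
  by rewrite imsetU !imset_set1 mem_edges.
apply/trivIsetP=> _ _ /imsetP[e eN' ->] /imsetP[f fN' ->] nef.
have {}nef : e != f by apply: contraNneq nef => ->.
rewrite -setI_eq0 -imsetI; last by move=> x y _ _ /val_inj.
have := trivIsetP tN _ _ eN' fN' nef.
by rewrite -setI_eq0 => /eqP ->; rewrite imset0.
Qed.

Lemma lift_cover (N : {set {set induced A}}) :
  cover [set val @: e | e : {set induced A} in N] = val @: cover N.
Proof.
apply/setP=> x; rewrite cover_imset.
apply/bigcupP/imsetP => [[e eN /imsetP[y ye ->]]|[y /bigcupP[e eN ye] ->]].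
  by exists y => //; apply/bigcupP; exists e.
by exists e => //; apply: imset_f.
Qed.

Lemma lift_matchable (W : {set induced A}) : matchable W -> matchable (val @: W).
Proof.
case=> N mN <-; exists [set val @: e | e : {set induced A} in N].
  exact: lift_matching.
exact: lift_cover.
Qed.

End Lift.

(** * Recognizing complete and complete bipartite graphs *)

Lemma isomorphic_of_embedding (G H : sgraph) (g : H -> G) :
  injective g -> #|G| <= #|H| -> {mono g : x y / adj x y} -> isomorphic G H.
Proof.
move=> gi gc gm; have [f gK fK] := inj_card_bij gi gc.
exists f; first by exists g.
by move=> x y; rewrite -gm !fK.
Qed.

Lemma isomorphic_complete (G : sgraph) : (forall x y : G, x != y -> adj x y) ->
  isomorphic G (complete_graph #|G|).
Proof.
move=> cG; apply: (@isomorphic_of_embedding _ (complete_graph _) enum_val).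
- exact: enum_val_inj.
- by rewrite card_ord.
move=> x y /=; rewrite /complete_adj; case: eqP => [->|nxy].
  by rewrite adj_irrefl.
by apply: cG; apply/eqP=> /enum_val_inj.
Qed.

Lemma isomorphic_complete_bipartite (G : sgraph) (B : {set G}) n :
  #|B| = n -> #|~: B| = n ->
  (forall x y : G, adj x y = (x \in B) (+) (y \in B)) ->
  isomorphic G (complete_bipartite n n).
Proof.
move=> cB cB' aG.
pose g (i : 'I_n + 'I_n) : G := match i with
  | inl i => enum_val (cast_ord (esym cB) i)
  | inr i => enum_val (cast_ord (esym cB') i) end.
have gB i : (g i \in B) = if i is inl _ then true else false.
  case: i => i /=; first exact: enum_valP.
  by have := enum_valP (cast_ord (esym cB') i); rewrite inE => /negbTE.
apply: (@isomorphic_of_embedding _ (complete_bipartite n n) g).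
- move=> i j E; have := gB i; rewrite E gB.
  by case: i j E => i [] j //= /enum_val_inj /cast_ord_inj ->.
- by rewrite card_sum !card_ord -(cardsC B) cB cB'.
- by move=> i j; rewrite aG !gB; case: i j => i [] j.
Qed.

(** * Sumner's theorem on randomly matchable graphs *)
Section RandomlyMatchable.
Variable G : sgraph.
Hypothesis Gconn : connected G.
Hypothesis Gmax : forall N, maxset (@matching G) N -> cover N = [set: G].

(** Extend a matching of [W] to a maximal one, which is perfect; the added edges cover the
    complement. *)
Lemma matchable_setC (W : {set G}) : matchable W -> matchable (~: W).
Proof.
case=> N mN <-; have [N' mN' sN] := maxset_exists mN.
exists (N' :\: N).
  by apply: matchingS (subsetDl _ _) _; apply: maxsetp mN'.
by rewrite (cover_matchingD (maxsetp mN')) // (Gmax mN') setTD.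
Qed.

(** The complement of [W] is matchable, and t is the partner of u there. *)
Lemma unmatched_neighbor (W : {set G}) u : matchable W -> u \notin W ->
  exists2 t, t \notin W & adj u t.
Proof.
move=> /matchable_setC[N mN cN] uW.
have : u \in cover N by rewrite cN inE.
case/bigcupP=> e eN ue; have /edgesP[x [y [xy E]]] := matching_edge mN eN.
have eW z : z \in e -> z \notin W.
  by move=> ze; rewrite -in_setC -cN; apply/bigcupP; exists e.
move: ue; rewrite E !inE => /orP[] /eqP ->.
  by exists y => //; apply: eW; rewrite E !inE eqxx orbT.
by exists x; rewrite 1?adj_sym //; apply: eW; rewrite E !inE eqxx.
Qed.

(* Exchange the edges ab, cd of a perfect matching for bc. *)
Lemma path4_closed (a b c d : G) : uniq [:: a; b; c; d] ->
  adj a b -> adj b c -> adj c d -> adj a d.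
Proof.
rewrite /= !inE !negb_or => /and4P[/and3P[ab ac ad] /andP[bc bd] cd _] eab ebc ecd.
have mW : matchable (~: ([set a; b] :|: [set c; d])).
  apply: matchable_setC; apply: matchable_add => //.
  - by rewrite !inE negb_or ac.
  - by rewrite !inE negb_or bc.
  exact: matchable_pair.
have := @matchable_add _ b c _ ebc _ _ mW.
rewrite !inE !eqxx ?orbT => /(_ isT isT) mW'.
(* Now only a and d are unmatched, so the partner t of a must be d. *)
have [|t] := unmatched_neighbor (u := a) mW'.
  by rewrite !inE eqxx (negbTE ab) (negbTE ac).
rewrite !inE => /norP[/norP[tb tc]].
rewrite negbK (negbTE tb) (negbTE tc) orbF /= => /orP[] /eqP -> //.
by rewrite adj_irrefl.
Qed.

Lemma closed_setT (S : {set G}) x : x \in S ->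
  (forall y z, y \in S -> adj y z -> z \in S) -> forall y, y \in S.
Proof.
move=> xS cS y; rewrite -(@closed_connect _ (@adj G) S _ x y) //.
apply: intro_closed; first exact/sym_connect_sym/adj_sym.
by move=> s t st sS; apply: cS st.
Qed.

(** Take a maximal clique K containing the triangle, and suppose that y in K has a neighbour z
    outside. For t in K other than y, the triangle supplies w in K distinct from t and y, and the
    path z, y, w, t closes up. So z is adjacent to all of K, against maximality. *)
Lemma triangle_complete (a b c : G) : adj a b -> adj b c -> adj a c ->
  forall x y : G, x != y -> adj x y.
Proof.
move=> ab bc ac.
pose clique (K : {set G}) := [forall x in K, forall y in K, (x != y) ==> adj x y].
have cliqueP (K : {set G}) :
    reflect {in K &, forall x y, x != y -> adj x y} (clique K).
  apply: (iffP forall_inP) => [cK x y xK yK xy|cK x xK].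
    by have /forall_inP/(_ _ yK)/implyP := cK x xK; apply.
  by apply/forall_inP=> y yK; apply/implyP; apply: cK.
have c3 : clique [set a; b; c].
  apply/cliqueP=> x y; rewrite !inE -!orbA.
  by do 2 case/or3P=> /eqP ->; rewrite ?eqxx // adj_sym.
have [K mK sK] := maxset_exists c3.
have /cliqueP cK := maxsetp mK.
have aK : a \in K by rewrite (subsetP sK) // !inE eqxx.
have bK : b \in K by rewrite (subsetP sK) // !inE eqxx ?orbT.
have cK' : c \in K by rewrite (subsetP sK) // !inE eqxx ?orbT.
suff KT : forall y, y \in K by move=> x y; apply: cK.
apply: (closed_setT aK) => y z yK yz; apply: contraT => zK.
have zall t : t \in K -> adj z t.
  move=> tK; have [->|ty] := eqVneq t y; first by rewrite adj_sym.
  have [w wK /andP[wt wy]] : exists2 w, w \in K & (w != t) && (w != y).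
    move: (adj_neq ab) (adj_neq bc) (adj_neq ac) => nab nbc nac.
    have [ta|ta] := eqVneq a t.
      have [yb|yb] := eqVneq b y.
        by exists c => //; rewrite -ta -yb !(eq_sym c) nac nbc.
      by exists b => //; rewrite -ta (eq_sym b) nab.
    have [ya|ya] := eqVneq a y; last by exists a; rewrite // ta.
    have [tb|tb] := eqVneq b t.
      by exists c => //; rewrite -ya -tb !(eq_sym c) nac nbc.
    by exists b => //; rewrite tb -ya eq_sym.
  have zw : forall k, k \in K -> z != k by move=> k kK; apply: contraNneq zK => ->.
  apply: (@path4_closed z y w t).
  - by rewrite /= !inE !negb_or !zw //= wt eq_sym wy eq_sym ty.
  - by rewrite adj_sym.
  - by apply: cK => //; rewrite eq_sym.
  - exact: cK.
suff /(maxsetsup mK)/(_ (subsetUr _ _)) E : clique (z |: K).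
  by case/negP: zK; rewrite -E !inE eqxx.
apply/cliqueP=> s t; rewrite !inE.
case/orP=> [/eqP ->|sK']; case/orP=> [/eqP ->|tK'].
- by rewrite eqxx.
- by rewrite zall.
- by rewrite adj_sym zall.
- exact: cK.
Qed.

(** The two sides are the neighbours of a and the other vertices, a among the latter. Closing paths
    of four vertices shows first that every vertex is within distance two of a, then that every
    non-neighbour of a is adjacent to every neighbour of a. *)
Lemma triangle_free_bipartite :
  (forall a b c : G, adj a b -> adj b c -> ~~ adj a c) ->
  forall a x y : G, adj x y = adj a x (+) adj a y.
Proof.
move=> tf a.
have dist2 : forall x, [|| x == a, adj a x | [exists b, adj a b && adj b x]].
  move=> x.
  pose S := [set x | [|| x == a, adj a x | [exists b, adj a b && adj b x]]].
  suff : x \in S by rewrite inE.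
  apply: (@closed_setT S a); first by rewrite inE eqxx.
  move=> y z; rewrite !inE => /or3P[/eqP ->|ay|/existsP[b /andP[ab yb]]] yz.
  - by rewrite yz orbT.
  - by apply/or3P/Or33/existsP; exists y; rewrite ay.
  - case: (eqVneq z a) => //= za.
    have [->|zb] := eqVneq z b; first by rewrite ab.
    have [ya|ya] := eqVneq y a; first by rewrite -ya yz.
    apply/orP; left; apply: (@path4_closed a b y z) => //.
    rewrite /= !inE !negb_or (adj_neq ab) (adj_neq yb) (adj_neq yz).
    by rewrite ![a == _]eq_sym ya za eq_sym zb.
have full x b : ~~ adj a x -> adj a b -> adj x b.
  move=> nax ab; have [->//|xa] := eqVneq x a.
  move: (dist2 x); rewrite (negbTE xa) (negbTE nax) /=.
  case/existsP=> b' /andP[ab' b'x].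
  have [->|bb'] := eqVneq b b'; first by rewrite adj_sym.
  apply: (@path4_closed x b' a b) => //; last 2 first.
  - by rewrite adj_sym.
  - by rewrite adj_sym.
  rewrite /= !inE !negb_or (eq_sym x b') (adj_neq b'x) xa (adj_neq ab).
  rewrite (eq_sym b') (adj_neq ab') (eq_sym b') bb' !andbT.
  by apply: contraNneq nax => ->.
move=> x y; case: (boolP (adj a x)) => ax; case: (boolP (adj a y)) => ay /=.
- by apply/negbTE; apply: (tf x a y) => //; rewrite adj_sym.
- by rewrite adj_sym full.
- exact: full.
- apply/negbTE/negP=> xy.
  (* A perfect matching gives a some neighbour b, and two adjacent non-neighbours of a would form a
     triangle with b. *)
  have [b _ ab] : exists2 t, t \notin set0 & adj a t.
    by apply: unmatched_neighbor; [exact: matchable0 | rewrite inE].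
  have xb := full x b ax ab; have yb := full y b ay ab.
  by move: (tf _ _ _ xy yb); rewrite xb.
Qed.

Theorem randomly_matchable_classification :
  exists n, isomorphic G (complete_graph (2 * n)) \/
            isomorphic G (complete_bipartite n n).
Proof.
have [N mN cN] : matchable [set: G].
  by rewrite -setC0; apply: matchable_setC; apply: matchable0.
have cG : #|G| = 2 * #|N| by rewrite -card_cover_matching // cN cardsT.
exists #|N|.
have [/existsP[a /existsP[b /existsP[c /and3P[ab bc ac]]]]|tf] :=
  boolP [exists a : G, exists b, exists c, [&& adj a b, adj b c & adj a c]].
  left; rewrite -cG; apply: isomorphic_complete.
  exact: triangle_complete ab bc ac.
have {}tf (a b c : G) : adj a b -> adj b c -> ~~ adj a c.
  move=> ab bc; apply: contra tf => ac.
  apply/existsP; exists a; apply/existsP; exists b; apply/existsP; exists c.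
  exact/and3P.
(* The empty graph offers no base vertex a; it is the complete graph on 0 vertices. *)
have [/eqP G0|/card_gt0P[a _]] := posnP #|G|.
  left; rewrite -cG; apply: isomorphic_complete => x.
  by have := fintype0 x (eqP G0).
right; pose B := [set x | adj a x].
have bip x y : adj x y = (x \in B) (+) (y \in B).
  by rewrite !inE; apply: triangle_free_bipartite.
suff cB : #|B| = #|N|.
  apply: (@isomorphic_complete_bipartite _ B) => //.
  by apply/eqP; rewrite -(eqn_add2l #|B|) cardsC cG cB mul2n addnn.
have /andP[_ tN] := mN.
(* Count B along the perfect matching: each edge of [N] has exactly one end in B. *)
transitivity (\sum_(x in cover N) (x \in B : nat)).
  rewrite cN -sum1_card big_mkcond [RHS]big_mkcond; apply: eq_bigr => x _.
  by rewrite [in RHS]inE; case: ifP.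
rewrite big_trivIset // (eq_bigr (fun=> 1)) ?sum1_card // => e eN.
have /edgesP[x [y [xy ->]]] := matching_edge mN eN.
rewrite big_setU1 /= ?big_set1; last by rewrite inE adj_neq.
by move: xy; rewrite bip; case: (x \in B); case: (y \in B).
Qed.

End RandomlyMatchable.

(** * Odd closed sets, cut vertices and isolated vertices *)

Section ClosedSets.
Variable G : sgraph.
Implicit Types (W S : {set G}) (N : {set {set G}}).

(** If [N] covered S, then each edge of [N] meeting S would lie inside S, since an end in [cover N0]
    would make it an edge of [N0], which avoids S. So S would be even. *)
Lemma odd_closed_uncovered N0 N S : N0 \subset N -> matching N -> odd #|S| ->
  [disjoint S & cover N0] ->
  (forall s t, s \in S -> adj s t -> t \in cover N0 :|: S) ->
  exists2 u, u \in S & u \notin cover N.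
Proof.
move=> sN mN oS dS cS; have /andP[_ tN] := mN.
apply/exists_inP; apply: contraLR oS => nu.
have Scov x : x \in S -> x \in cover N.
  by move=> xS; apply: contraNT nu => xN; apply/exists_inP; exists x.
pose F := [set e in N | e \subset S].
have mF : matching F by apply: matchingS mN; apply/subsetP=> e; rewrite inE => /andP[].
suff <- : cover F = S by rewrite card_cover_matching // oddM.
apply/setP=> x; apply/bigcupP/idP=> [[e]|xS].
  by rewrite inE => /andP[_ /subsetP eS] /eS.
have /bigcupP[e eN xe] := Scov x xS; exists e => //; rewrite inE eN /=.
have xN0 : x \notin cover N0 by rewrite (disjointFr dS xS).
have eS t : t \in e -> adj x t -> t \in S.
  move=> te xt; have := cS x t xS xt; rewrite inE => /orP[/bigcupP[f fN0 tf]|//].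
  case/negP: xN0; apply/bigcupP; exists e => //.
  by rewrite -(def_pblock tN eN te) (def_pblock tN (subsetP sN _ fN0) tf).
have /edgesP[a [b [ab E]]] := matching_edge mN eN.
apply/subsetP=> t; have [->//|tx] := eqVneq t x; move=> te; apply: eS => //.
move: te xe tx; rewrite E !inE.
by do 2 case/orP=> /eqP ->; rewrite ?eqxx // adj_sym.
Qed.

(** The form in which 2-connectedness is used: x is not a cut vertex, so a set reaching outside x
    and closed under adjacency in G - x exhausts G - x. *)
Lemma closed_minus_vertex x S s : k_connected 2 G ->
  s \in S -> s != x ->
  (forall y z, y \in S -> y != x -> adj y z -> z != x -> z \in S) ->
  forall y, y != x -> y \in S.
Proof.
move=> [_ /(_ [set x])]; rewrite cards1 => /(_ isT) cG sS sx cS y yx.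
have in' z : z != x -> z \in ~: [set x] by rewrite !inE.
pose S' := [set z : del_vertices [set x] | val z \in S].
have /(_ (Sub y (in' y yx))) : forall z, z \in S'; last by rewrite inE.
apply: (closed_setT cG (x := Sub s (in' s sx))); first by rewrite inE.
move=> [z zx] [t tx]; rewrite !inE /= /induced_adj /= => zS zt.
move: zx tx; rewrite !inE => zx tx; exact: cS zt tx.
Qed.

(** Replaces components over a subtype by a condition on neighbours in G. *)
Lemma isolatesP N v : isolates N v <->
  v \notin cover N /\ forall u, adj v u -> u \in cover N.
Proof.
split=> [[C /imsetP[x _ ->] E]|[vN nv]].
  have : v \in [set v] by rewrite inE.
  rewrite -E => /imsetP[y yC vy].
  have vN : v \notin cover N by have := valP y; rewrite inE -vy.
  split=> // u vu; apply: contraT => uN.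
  have uN' : u \in ~: cover N by rewrite inE.
  have : u \in [set v].
    rewrite -E; apply/imsetP; exists (Sub u uN') => //.
    move: yC; rewrite !inE => xy; apply: connect_trans xy (connect1 _).
    by rewrite /= /induced_adj /= -vy.
  by rewrite inE => /eqP uv; move: vu; rewrite uv adj_irrefl.
have vN' : v \in ~: cover N by rewrite inE.
pose v' : del_vertices (cover N) := Sub v vN'.
exists [set y in [set: del_vertices (cover N)] | connect (@adj _) v' y].
  by apply/imsetP; exists v'.
have iso y : connect (@adj (del_vertices (cover N))) v' y -> y = v'.
  case/connectP=> [[|z p] //= /andP[vz _]].
  have /nv := vz; have := valP z; by rewrite inE => /negbTE ->.
apply/setP=> u; rewrite inE; apply/imsetP/eqP => [[y]|->].
  by rewrite !inE /= => /iso -> ->.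
by exists v'; rewrite ?inE //= connect0.
Qed.

End ClosedSets.

(** * Maximal matchings of equimatchable factor-critical graphs *)

Section EquimatchableFactorCritical.
Variable G : sgraph.
Hypotheses (hfc : factor_critical G) (heq : equimatchable G).

(** A perfect matching of G - w, seen in G, covers all vertices but one, and [N], being maximum,
    covers at least as many. *)
Lemma maximal_matching_uncovered N :
  maxset (@matching G) N -> #|~: cover N| <= 1.
Proof.
move=> mN; have [->//|/card_gt0P[w _]] := posnP #|~: cover N|.
have [M /andP[mM /eqP cM]] := hfc w.
have [mN' /(_ _ (lift_matching mM))] := heq mN.
rewrite -(leq_pmul2l (ltn0Sn 1)) -!card_cover_matching ?lift_matching //.
rewrite lift_cover cM (card_imset _ val_inj) cardsT /= card_sig.
rewrite -[#|[pred x | _]|]/#|[set~ w]| cardsC1.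
move=> le_cov; rewrite -(leq_add2l #|cover N|) cardsC addn1.
exact: leq_trans (leqSpred _) _.
Qed.

(* A maximal matching extending one that covers W would miss a vertex of each
   of S1 and S2. *)
Lemma no_two_odd_closed (W S1 S2 : {set G}) : matchable W ->
  odd #|S1| -> odd #|S2| -> [disjoint S1 & W] -> [disjoint S2 & W] ->
  [disjoint S1 & S2] ->
  (forall s t, s \in S1 -> adj s t -> t \in W :|: S1) ->
  (forall s t, s \in S2 -> adj s t -> t \in W :|: S2) -> False.
Proof.
case=> N0 mN0 <- o1 o2 d1 d2 d12 c1 c2; have [N mN sN] := maxset_exists mN0.
have [u1 u1S u1N] := odd_closed_uncovered sN (maxsetp mN) o1 d1 c1.
have [u2 u2S u2N] := odd_closed_uncovered sN (maxsetp mN) o2 d2 c2.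
have nu : u1 != u2 by apply: contraTneq u1S => ->; rewrite (disjointFl d12 u2S).
suff : 1 < #|~: cover N| by rewrite ltnNge maximal_matching_uncovered.
have <- : #|[set u1; u2]| = 2 by rewrite cards2 nu.
by apply: subset_leq_card; rewrite subUset !sub1set !inE u1N.
Qed.

End EquimatchableFactorCritical.

(** * The minimal isolating matching and the components of the rest *)

Section IsolatingMatching.
Variable G : sgraph.
Hypotheses (hconn : k_connected 2 G) (hfc : factor_critical G)
  (heq : equimatchable G).
Variables (v : G) (M : {set {set G}}).
Hypothesis hM : minimal_isolating_matching M v.

Local Notation U := (cover M).
Local Notation H := (~: (U :|: [set v])).

Let mM : matching M.
Proof. by case: hM. Qed.

Let tM : trivIset M.
Proof. by case/andP: mM. Qed.

Let vU : v \notin U.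
Proof. by case: hM => _ /isolatesP[]. Qed.

Lemma isolated_neighbor u : adj v u -> u \in U.
Proof. by case: hM => _ /isolatesP[_ h] _; apply: h. Qed.

Lemma in_rest x : (x \in H) = (x \notin U) && (x != v).
Proof. by rewrite !inE negb_or. Qed.

Lemma U_neq_rest c x : c \in H -> x \in U -> x != c.
Proof.
by rewrite in_rest => /andP[cU _] xU; apply: contraNneq cU => <-.
Qed.

Lemma rest_neq_v c : c \in H -> c != v.
Proof. by rewrite in_rest => /andP[]. Qed.

Lemma U_neq_v x : x \in U -> x != v.
Proof. by move=> xU; apply: contraNneq vU => <-. Qed.

Lemma rest_not_adj_v c : c \in H -> ~~ adj c v.
Proof.
rewrite in_rest adj_sym => /andP[cU _]; apply: contra cU.
exact: isolated_neighbor.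
Qed.

Definition mate x y := [set x; y] \in M.

Lemma mate_sym x y : mate x y -> mate y x.
Proof. by rewrite /mate setUC. Qed.

Lemma mateP x y : mate x y -> [/\ x \in U, y \in U & adj x y].
Proof.
move=> xy; split; last by rewrite -mem_edges (matching_edge mM).
  by apply/bigcupP; exists [set x; y]; rewrite ?inE ?eqxx.
by apply/bigcupP; exists [set x; y]; rewrite ?inE ?eqxx ?orbT.
Qed.

Lemma mate_exists x : x \in U -> exists y, mate x y.
Proof.
case/bigcupP=> e eM xe; have /edgesP[a [b [ab E]]] := matching_edge mM eM.
rewrite /mate; move: xe eM; rewrite E !inE => /orP[] /eqP -> eM; first by exists b.
by exists a; rewrite setUC.
Qed.

Lemma mate_disjoint x y x' y' : mate x y -> mate x' y' ->
  x' != x -> x' != y -> y' != x /\ y' != y.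
Proof.
move=> xy xy' nx ny; suff : y' \notin [set x; y] by rewrite !inE negb_or => /andP.
apply/negP=> y'e.
have y'e' : y' \in [set x'; y'] by rewrite !inE eqxx orbT.
have : x' \in [set x'; y'] by rewrite !inE eqxx.
rewrite -(def_pblock tM xy' y'e') (def_pblock tM xy y'e).
by rewrite !inE (negbTE nx) (negbTE ny).
Qed.

(** By minimality: an edge of [M] with no end adjacent to v could be dropped and v would stay
    isolated. *)
Lemma mate_adj_v x y : mate x y -> adj v x || adj v y.
Proof.
move=> xy; case: hM => _ _ /(_ (M :\ [set x; y])).
rewrite properD1 // => /(_ isT) nI; apply: contraT => /norP[vx vy].
case: nI; apply/isolatesP; rewrite coverD1 //; split.
  by rewrite inE (negbTE vU) andbF.
move=> u vu; rewrite !inE isolated_neighbor // andbT negb_or.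
by apply/andP; split; [apply: contraNneq vx => <-|apply: contraNneq vy => <-].
Qed.

(** Adjacency in [H] as a relation on G, so that components of [H] are sets of vertices of G. *)
Definition rest_adj : rel G := fun x y => [&& adj x y, x \in H & y \in H].
Local Notation linked := (connect rest_adj).

Lemma linked_sym x y : linked x y = linked y x.
Proof.
by apply: sym_connect_sym => a b; rewrite /rest_adj adj_sym [(a \in _) && _]andbC.
Qed.

Definition comp c := [set x in H | linked c x].

Lemma comp_rest c x : x \in comp c -> x \in H.
Proof. by case/setIdP. Qed.

Lemma comp_linked c x : x \in comp c -> linked c x.
Proof. by case/setIdP. Qed.

Lemma comp_refl c : c \in H -> c \in comp c.
Proof. by move=> cH; apply/setIdP; split; rewrite ?connect0. Qed.

Lemma mem_comp c x : x \in H -> linked c x -> x \in comp c.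
Proof. by move=> xH cx; apply/setIdP. Qed.

Lemma comp_adj c s t : s \in comp c -> adj s t -> t \in U :|: comp c.
Proof.
move=> sC st; rewrite inE; have [//|tU /=] := boolP (t \in U).
have sH := comp_rest sC.
have tH : t \in H.
  by rewrite in_rest tU; apply: contraNneq (rest_not_adj_v sH) => <-.
apply: mem_comp => //; apply: connect_trans (comp_linked sC) (connect1 _).
by rewrite /rest_adj st sH tH.
Qed.

(** If odd, the component and the single vertex v would be two odd sets closed up to [U]. *)
Lemma comp_even c : c \in H -> ~~ odd #|comp c|.
Proof.
move=> cH; apply/negP=> oC.
apply: (@no_two_odd_closed _ hfc heq U [set v] (comp c)) => //.
- exact: matchable_cover.
- by rewrite cards1.
- by rewrite disjoints1.
- apply/pred0P=> x /=; apply/negP=> /andP[/comp_rest].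
  by rewrite in_rest => /andP[/negP].
- by rewrite disjoints1; apply/negP=> /comp_rest /rest_neq_v; rewrite eqxx.
- by move=> s t; rewrite inE => /eqP -> /isolated_neighbor tU; rewrite inE tU.
- by move=> s t; apply: comp_adj.
Qed.

(* The closed odd sets are [set u] and comp c minus c. *)
Lemma no_isolated_with_odd_comp W u c : matchable W -> c \in H ->
  (forall x, x \in comp c -> (x \in W) = (x == c)) ->
  u \notin W -> u \notin H -> (forall t, adj u t -> t \in W) ->
  (forall s t, s \in comp c -> adj s t -> t \in U -> t \in W) -> False.
Proof.
move=> mW cH CW uW uH au aC; have cC := comp_refl cH.
apply: (@no_two_odd_closed _ hfc heq W [set u] (comp c :\ c)) => //.
- by rewrite cards1.
- by have := comp_even cH; rewrite (cardsD1 c) cC /= negbK.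
- by rewrite disjoints1.
- apply/pred0P=> x /=; apply/negP=> /andP[]; rewrite in_setD1 => /andP[xc xC].
  by rewrite CW // (negbTE xc).
- rewrite disjoints1 in_setD1 negb_and negbK; apply/orP; right.
  by apply: contra uH => /comp_rest.
- by move=> s t; rewrite inE => /eqP -> /au; rewrite inE => ->.
- move=> s t; rewrite in_setD1 => /andP[_ sC] st; rewrite inE in_setD1.
  have := comp_adj sC st; rewrite inE => /orP[/(aC _ _ sC st) -> //|tC].
  by have [->|/= _] := eqVneq t c; rewrite ?CW ?eqxx // tC orbT.
Qed.

Lemma matchable_coverD (F : {set {set G}}) : F \subset M -> matchable (U :\: cover F).
Proof.
move=> sF; exists (M :\: F); last exact: cover_matchingD.
exact: matchingS (subsetDl _ _) mM.
Qed.

(** Replace the edge xy of [M] by xc and yd. *)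
Lemma matchable_swap1 x y c d : mate x y -> adj x c -> adj y d ->
  c \in H -> d \in H -> c != d -> matchable ([set c; d] :|: U).
Proof.
move=> xy xc yd cH dH cd; have [xU yU axy] := mateP xy.
have := @matchable_coverD [set [set x; y]]; rewrite sub1set cover1 => /(_ xy) mR.
have cU := U_neq_rest cH; have dU := U_neq_rest dH.
have nc : c \notin U by move: cH; rewrite in_rest => /andP[].
have nd : d \notin U by move: dH; rewrite in_rest => /andP[].
have mY : matchable ([set y; d] :|: (U :\: [set x; y])).
  by apply: matchable_add => //; rewrite !inE ?eqxx ?orbT ?(negbTE nd) ?andbF.
suff : matchable ([set x; c] :|: ([set y; d] :|: (U :\: [set x; y]))).
  apply: matchable_eq => t; rewrite !inE.
  have [->|tx] := eqVneq t x; first by rewrite xU orbT.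
  have [->|ty] := eqVneq t y; first by rewrite yU !orbT.
  by rewrite /= orbA.
apply: matchable_add => //; rewrite !inE.
  by rewrite eqxx (negbTE (adj_neq axy)) (negbTE (dU x xU)).
by rewrite eq_sym (negbTE (cU y yU)) (negbTE cd) (negbTE nc) andbF.
Qed.

(** Replace the edges z1w1 and z2w2 of [M] by z1c and z2d, which sets w1 and w2 free. *)
Lemma matchable_swap2 z1 w1 z2 w2 c d : mate z1 w1 -> mate z2 w2 ->
  z2 != z1 -> z2 != w1 -> adj z1 c -> adj z2 d ->
  c \in H -> d \in H -> c != d ->
  matchable ([set c; d] :|: (U :\: [set w1; w2])).
Proof.
move=> m1 m2 zz zw z1c z2d cH dH cd.
have [z1U w1U a1] := mateP m1; have [z2U w2U a2] := mateP m2.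
have [wz ww] := mate_disjoint m1 m2 zz zw.
have := @matchable_coverD [set [set z1; w1]; [set z2; w2]].
rewrite subUset !sub1set => /(_ (introT andP (conj m1 m2))).
rewrite /cover bigcup_setU !big_set1 => mR.
have cU := U_neq_rest cH; have dU := U_neq_rest dH.
have nc : c \notin U by move: cH; rewrite in_rest => /andP[].
have nd : d \notin U by move: dH; rewrite in_rest => /andP[].
set R := (X in matchable X) in mR.
have mY : matchable ([set z2; d] :|: R).
  by apply: matchable_add => //; rewrite !inE ?eqxx ?orbT ?(negbTE nd) ?andbF.
suff : matchable ([set z1; c] :|: ([set z2; d] :|: R)).
  apply: matchable_eq => t; rewrite !inE.
  have [->|tx] := eqVneq t z1.
    by rewrite z1U (negbTE (adj_neq a1)) (eq_sym z1 w2) (negbTE wz) orbT.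
  have [->|ty] := eqVneq t z2.
    by rewrite z2U (negbTE zw) (negbTE (adj_neq a2)) !orbT.
  by rewrite /= orbA.
apply: matchable_add => //; rewrite !inE.
  by rewrite eqxx (eq_sym z1 z2) (negbTE zz) (negbTE (dU z1 z1U)).
by rewrite eq_sym (negbTE (cU z2 z2U)) (negbTE cd) (negbTE nc) andbF.
Qed.

Lemma unlinked_neq c d : ~~ linked c d -> c != d.
Proof. by apply: contraNneq => ->; rewrite connect0. Qed.

Lemma unlinked_notin_comp c d : ~~ linked c d -> d \notin comp c.
Proof. by apply: contra => /comp_linked. Qed.

(** If c and d lay in different components, replacing xy by xc and yd would keep [U] covered, hence
    v isolated, and take just the vertex c from its component, leaving an odd set. *)
Lemma mates_linked x y c d : mate x y -> adj x c -> adj y d ->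
  c \in H -> d \in H -> linked c d.
Proof.
move=> xy xc yd cH dH; apply: contraT => ncd; exfalso.
have mW := matchable_swap1 xy xc yd cH dH (unlinked_neq ncd).
apply: (@no_isolated_with_odd_comp _ v c mW) => //.
- move=> s sC; rewrite !inE.
  have [sd|_] := eqVneq s d.
    by move: sC; rewrite sd (negbTE (unlinked_notin_comp ncd)).
  have := comp_rest sC; rewrite in_rest => /andP[/negbTE -> _].
  by rewrite !orbF.
- by rewrite !inE !(eq_sym v) (negbTE (rest_neq_v cH)) (negbTE (rest_neq_v dH)).
- by rewrite in_rest eqxx andbF.
- by move=> t /isolated_neighbor tU; rewrite !inE tU orbT.
- by move=> s t _ _ tU; rewrite !inE tU orbT.
Qed.

(** * Two edges of the matching attached to different components *)

Section TwoEdges.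
Variables (z1 w1 z2 w2 c d : G).
Hypotheses (m1 : mate z1 w1) (m2 : mate z2 w2).
Hypotheses (zz : z2 != z1) (zw : z2 != w1).
Hypotheses (z1c : adj z1 c) (z2d : adj z2 d) (cH : c \in H) (dH : d \in H).
Hypothesis ncd : ~~ linked c d.

(** What is covered after exchanging z1w1, z2w2 for z1c, z2d. The vertices w1, w2 and v are free,
    and the component of c has lost only c; each lemma below isolates one of the three. *)
Let W1 := [set c; d] :|: (U :\: [set w1; w2]).

Let mW1 : matchable W1.
Proof. exact: matchable_swap2 m1 m2 zz zw z1c z2d cH dH (unlinked_neq ncd). Qed.

Let w1U : w1 \in U. Proof. by case: (mateP m1). Qed.
Let w2U : w2 \in U. Proof. by case: (mateP m2). Qed.

Let ww : w1 != w2.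
Proof. by rewrite eq_sym; case: (mate_disjoint m1 m2 zz zw). Qed.

Let w1W : w1 \notin W1.
Proof.
rewrite !inE eqxx.
by rewrite (negbTE (U_neq_rest cH w1U)) (negbTE (U_neq_rest dH w1U)).
Qed.

Let w2W : w2 \notin W1.
Proof.
rewrite !inE eqxx orbT.
by rewrite (negbTE (U_neq_rest cH w2U)) (negbTE (U_neq_rest dH w2U)).
Qed.

Let vW : v \notin W1.
Proof.
by rewrite !inE (negbTE vU) !(eq_sym v) andbF orbF negb_or !rest_neq_v.
Qed.

Let compW1 s : s \in comp c -> (s \in W1) = (s == c).
Proof.
move=> sC; have := comp_rest sC; rewrite in_rest !inE => /andP[/negbTE -> _].
have [sd|_] := eqVneq s d; last by rewrite andbF !orbF.
by move: sC; rewrite sd (negbTE (unlinked_notin_comp ncd)).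
Qed.

Let UW1 t : t \in U -> t != w1 -> t != w2 -> t \in W1.
Proof. by move=> tU t1 t2; rewrite !inE tU negb_or t1 t2 orbT. Qed.

(** Otherwise the edge z2w2 would have its ends attached to the different components of d and c. *)
Let w2_comp s : s \in comp c -> ~~ adj s w2.
Proof.
move=> sC; apply: contra ncd; rewrite adj_sym => w2s.
apply: connect_trans (comp_linked sC) _; rewrite linked_sym.
exact: mates_linked m2 z2d w2s dH (comp_rest sC).
Qed.

Let w1_rest t : t \in H -> adj w1 t -> t \in comp c.
Proof.
by move=> tH w1t; apply: mem_comp => //; apply: mates_linked m1 z1c w1t cH tH.
Qed.

(** Otherwise the edge w1w2 could be added, covering all of [U] again and isolating v. *)
Lemma mates_not_adj : ~~ adj w1 w2.
Proof.
apply/negP=> w12.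
apply: (@no_isolated_with_odd_comp ([set w1; w2] :|: W1) v c) => //.
- exact: matchable_add.
- move=> s sC; rewrite in_setU compW1 // !inE.
  have sH := comp_rest sC.
  rewrite (eq_sym s w1) (eq_sym s w2).
  by rewrite (negbTE (U_neq_rest sH w1U)) (negbTE (U_neq_rest sH w2U)).
- rewrite in_setU negb_or vW andbT !inE !(eq_sym v) negb_or.
  by rewrite (U_neq_v w1U) (U_neq_v w2U).
- by rewrite in_rest eqxx andbF.
- move=> t /isolated_neighbor tU; rewrite in_setU in_set2.
  by case: eqVneq => //= t1; case: eqVneq => //= t2; apply: UW1.
- move=> s t _ _ tU; rewrite in_setU in_set2.
  by case: eqVneq => //= t1; case: eqVneq => //= t2; apply: UW1.
Qed.

(** Add the edge vw2. The neighbours of w1 in [H] can lie only in the component of c, so if there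
    are none w1 is isolated. *)
Lemma mate_attached_of_adj_v : adj v w2 ->
  exists2 a, a \in comp c & adj w1 a.
Proof.
move=> vw2; apply/exists_inP; apply: contraT => /exists_inPn na; exfalso.
apply: (@no_isolated_with_odd_comp ([set v; w2] :|: W1) w1 c) => //.
- exact: matchable_add.
- move=> s sC; rewrite in_setU compW1 // !in_set2.
  have sH := comp_rest sC.
  by rewrite (negbTE (rest_neq_v sH)) (eq_sym s) (negbTE (U_neq_rest sH w2U)).
- by rewrite in_setU negb_or w1W andbT in_set2 negb_or U_neq_v.
- by rewrite in_rest w1U.
- move=> t w1t; rewrite in_setU in_set2.
  case: eqVneq => //= tv; case: eqVneq => //= t2.
  have [tU|tU] := boolP (t \in U).
    by apply: UW1 => //; rewrite eq_sym adj_neq.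
  have tH : t \in H by rewrite in_rest tU.
  by have := na _ (w1_rest tH w1t); rewrite w1t.
- move=> s t sC st tU; rewrite in_setU in_set2.
  case: eqVneq => //= tv; case: eqVneq => //= t2.
  apply: UW1 => //; apply: contraTneq st => ->.
  by rewrite adj_sym na.
Qed.

(** If both conclusions failed, w2 would be isolated by [W1]: it is adjacent neither to v nor to w1,
    and its neighbours in [H] could lie only in the component of d. *)
Lemma mates_attached_alternative : ~~ adj v w2 ->
  (forall a, a \in comp c -> ~~ adj w1 a) ->
  exists2 a, a \in comp d & adj w2 a.
Proof.
move=> vw2 na; apply/exists_inP; apply: contraT => /exists_inPn nb; exfalso.
apply: (@no_isolated_with_odd_comp W1 w2 c) => //.
- by rewrite in_rest w2U.
- move=> t w2t; have [tU|tU] := boolP (t \in U).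
    apply: UW1 => //; last by rewrite eq_sym adj_neq.
    by apply: contraTneq w2t => ->; rewrite adj_sym mates_not_adj.
  have tv : t != v by apply: contraNneq vw2 => <-; rewrite adj_sym.
  have tH : t \in H by rewrite in_rest tU.
  suff /nb : t \in comp d by rewrite w2t.
  by apply: mem_comp => //; apply: mates_linked m2 z2d w2t dH tH.
- move=> s t sC st tU; apply: UW1 => //; apply: contraTneq st => ->.
    by rewrite adj_sym na.
  exact: w2_comp.
Qed.

End TwoEdges.

(** If w2 is not adjacent to v, then z2 is. Were w1 unattached to the component of c, w2 would be
    attached to that of d, and z2 and w2 could exchange roles. *)
Lemma mate_attached z1 w1 z2 w2 c d : mate z1 w1 -> mate z2 w2 ->
  z2 != z1 -> z2 != w1 -> adj z1 c -> adj z2 d -> c \in H -> d \in H ->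
  ~~ linked c d -> exists2 a, a \in comp c & adj w1 a.
Proof.
move=> m1 m2 zz zw z1c z2d cH dH ncd.
have [vw2|vw2] := boolP (adj v w2).
  exact: mate_attached_of_adj_v m1 m2 zz zw z1c z2d cH dH ncd vw2.
apply/exists_inP; apply: contraT => /exists_inPn na.
have [b bC w2b] := mates_attached_alternative m1 m2 zz zw z1c z2d cH dH ncd vw2 na.
have [wz ww] := mate_disjoint m1 m2 zz zw.
have ncb : ~~ linked c b.
  apply: contra ncd => cb; apply: connect_trans cb _.
  by rewrite linked_sym comp_linked.
have vz2 : adj v z2 by have := mate_adj_v m2; rewrite (negbTE vw2) orbF.
have [a aC w1a] := mate_attached_of_adj_v m1 (mate_sym m2) wz ww z1c w2b cH
  (comp_rest bC) ncb vz2.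
by have := na _ aC; rewrite w1a.
Qed.

(** Replace the edges sw, tt', xy of [M] by st, wc, vx, yd. Of [U] and v only t' is then free, and
    it is isolated because it has no neighbour in [H]. *)
Lemma no_edge_to_unattached s w t t' x y c d :
  mate s w -> mate t t' -> mate x y ->
  t != s -> t != w -> x != s -> x != w -> x != t -> x != t' ->
  adj s t -> adj w c -> adj y d -> adj v x -> c \in H -> d \in H ->
  ~~ linked c d -> (forall h, h \in H -> ~~ adj t' h) -> False.
Proof.
move=> ms mt mx ts tw xs xw xt xt' st wc yd vx cH dH ncd nt'.
have [sU wU asw] := mateP ms; have [tU t'U att] := mateP mt.
have [xU yU axy] := mateP mx.
have [t's t'w] := mate_disjoint ms mt ts tw.
have [ys yw] := mate_disjoint ms mx xs xw.
have [yt yt'] := mate_disjoint mt mx xt xt'.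
have := @matchable_coverD ([set [set s; w]; [set t; t']; [set x; y]]).
rewrite !subUset !sub1set => /(_ (introT andP (conj (introT andP (conj ms mt)) mx))).
rewrite /cover !bigcup_setU !big_set1 => mR.
set R := (X in matchable X) in mR.
have cU : c \notin U by move: cH; rewrite in_rest => /andP[].
have dU : d \notin U by move: dH; rewrite in_rest => /andP[].
have RE i : i \in R = [&& i \in U, i != s, i != w, i != t, i != t', i != x & i != y].
  by rewrite !inE !negb_or -!andbA [RHS]andbC -!andbA.
have nR i : i \notin U -> i \notin R by rewrite RE => /negbTE ->.
have E : forall i, (i \in [set v; c; d] :|: U :\ t') =
  (i \in [set s; t] :|: ([set w; c] :|: ([set v; x] :|: ([set y; d] :|: R)))).
  move=> i; rewrite in_setU in_setD1 !(in_setU, in_set1) RE.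
  have [iU|iU] := boolP (i \in U); last first.
    have n k : k \in U -> (i == k) = false.
      by move=> kU; apply/negbTE; apply: contraNneq iU => ->.
    rewrite (n s) // (n t) // (n w) // (n x) // (n y) // !andbF !orbF /=.
    by case: (i == v); case: (i == c); case: (i == d).
  rewrite (negbTE (U_neq_v iU)) (negbTE (U_neq_rest cH iU)).
  rewrite (negbTE (U_neq_rest dH iU)) /= !orbF.
  have [->|is_] := eqVneq i s; first by rewrite eq_sym t's.
  have [->|it] := eqVneq i t; first by rewrite adj_neq.
  have [->|iw] := eqVneq i w; first by rewrite eq_sym t'w.
  have [->|ix] := eqVneq i x; first by rewrite xt'.
  have [->|iy] := eqVneq i y; first by rewrite yt'.
  by rewrite /= !andbT.
have cne k : k \in U -> (c == k) = false.
  by move=> kU; rewrite eq_sym; apply/negbTE/U_neq_rest.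
have une k : k \in U -> [/\ (k == c) = false, (k == d) = false & (k == v) = false].
  move=> kU; split; apply/negbTE; [| |exact: U_neq_v].
  - exact: U_neq_rest.
  - exact: U_neq_rest.
have [xc xd xv] := une x xU; have [yc yd' yv] := une y yU.
have [wc' wd wv] := une w wU; have [sc sd sv] := une s sU.
have [tc td tv] := une t tU.
have mW : matchable ([set v; c; d] :|: U :\ t').
  apply: matchable_eq (fun i => esym (E i)) _.
  apply: matchable_add => //.
  - rewrite !(in_setU, in_set1) RE eqxx (negbTE (adj_neq asw)) sc sv sd.
    by rewrite !(eq_sym s) (negbTE xs) (negbTE ys) !andbF.
  - rewrite !(in_setU, in_set1) RE eqxx (negbTE tw) tc tv td.
    by rewrite !(eq_sym t) (negbTE xt) (negbTE yt) !andbF.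
  apply: matchable_add => //.
  - rewrite !(in_setU, in_set1) RE eqxx wv wd.
    by rewrite !(eq_sym w) (negbTE xw) (negbTE yw) !andbF.
  - rewrite !(in_setU, in_set1) RE (cne x) // (cne y) // (negbTE cU).
    rewrite (negbTE (unlinked_neq ncd)).
    by rewrite (negbTE (rest_neq_v cH)).
  apply: matchable_add => //.
  - rewrite !(in_setU, in_set1) RE (negbTE vU) !(eq_sym v) yv.
    by rewrite (negbTE (rest_neq_v dH)).
  - by rewrite !(in_setU, in_set1) RE eqxx xd (negbTE (adj_neq axy)) !andbF.
  apply: matchable_add => //; last exact: nR.
  by rewrite RE eqxx !andbF.
apply: (@no_isolated_with_odd_comp _ t' c mW) => //.
- move=> i iC; have iH := comp_rest iC.
  move: (iH); rewrite in_rest !inE => /andP[/negbTE -> /negbTE ->].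
  have [id|_] := eqVneq i d; last by rewrite andbF !orbF.
  by move: iC; rewrite id (negbTE (unlinked_notin_comp ncd)).
- have [t'c t'd t'v] := une t' t'U.
  by rewrite !inE eqxx t'c t'd t'v.
- by rewrite in_rest t'U.
- move=> i t'i; rewrite !inE.
  have [//|iv] := eqVneq i v; have [iU|iU] := boolP (i \in U).
    by rewrite (eq_sym i t') (adj_neq t'i) !orbT.
  by have := nt' i; rewrite in_rest iU iv t'i => /(_ isT).
- move=> a i aC ai iU; rewrite !inE iU andbT.
  have [it'|_] := eqVneq i t'; last by rewrite !orbT.
  by have := nt' a (comp_rest aC); rewrite adj_sym -it' ai.
Qed.

(** The component of c together with the vertices of [U] attached to it is closed in G - v and
    misses d, so v would be a cut vertex. *)
Lemma no_two_attached_edges z1 w1 z2 w2 c d : mate z1 w1 -> mate z2 w2 ->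
  z2 != z1 -> z2 != w1 -> adj z1 c -> adj z2 d -> c \in H -> d \in H ->
  ~~ linked c d -> False.
Proof.
move=> m1 m2 zz zw z1c z2d cH dH ncd.
have [wz ww] := mate_disjoint m1 m2 zz zw.
have ndc : ~~ linked d c by rewrite linked_sym.
have sep a b : a \in comp c -> b \in comp d -> ~~ linked a b.
  move=> aC bC; apply: contra ncd => ab.
  apply: connect_trans (comp_linked aC) (connect_trans ab _).
  by rewrite linked_sym comp_linked.
have [b2 b2C w2b2] : exists2 a, a \in comp d & adj w2 a.
  apply: mate_attached m2 m1 _ _ z2d z1c dH cH ndc; first by rewrite eq_sym.
  by rewrite eq_sym.
have dC := comp_refl dH; have b2H := comp_rest b2C.
(* Both ends of z2w2 are attached to the component of d, so by [mates_linked] neither is attached to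
   that of c. *)
have z2n a : a \in comp c -> ~~ adj z2 a.
  move=> aC; apply: contra (sep a b2 aC b2C) => z2a.
  exact: mates_linked m2 z2a w2b2 (comp_rest aC) b2H.
have w2n a : a \in comp c -> ~~ adj w2 a.
  move=> aC; apply: contra (sep a d aC dC) => w2a.
  exact: mates_linked (mate_sym m2) w2a z2d (comp_rest aC) dH.
(* An edge of [M] with one end attached to the component of c therefore differs from z2w2, and
   comparison with z2w2 shows its other end attached too. *)
have far s w a : mate s w -> a \in comp c -> adj s a ->
    [/\ s != z2, s != w2, z2 != s, z2 != w & exists2 b, b \in comp c & adj w b].
  move=> ms aC sa.
  have s1 : s != z2 by apply: contraTneq sa => ->; apply: z2n.
  have s2 : s != w2 by apply: contraTneq sa => ->; apply: w2n.
  have [w_z w_w] := mate_disjoint m2 ms s1 s2.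
  have zs : z2 != s by rewrite eq_sym.
  have zw' : z2 != w by rewrite eq_sym.
  split=> //.
  have [b bC wb] :=
    mate_attached ms m2 zs zw' sa z2d (comp_rest aC) dH (sep a d aC dC).
  exists b => //; apply: mem_comp; first exact: comp_rest bC.
  exact: connect_trans (comp_linked aC) (comp_linked bC).
pose S := [set x | (x \in comp c) || (x \in U) && [exists a in comp c, adj x a]].
have SU x a : x \in U -> a \in comp c -> adj x a -> x \in S.
  move=> xU aC xa; rewrite inE xU; apply/orP; right; apply/exists_inP.
  by exists a.
suff /(_ d (rest_neq_v dH)) : forall y, y != v -> y \in S.
  rewrite inE (negbTE (unlinked_notin_comp ncd)) /=.
  by move: dH; rewrite in_rest => /andP[/negbTE ->].
apply: (closed_minus_vertex hconn (s := c)); last 1 first.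
- move=> s t; rewrite {1}inE => /orP[sC|/andP[sU /exists_inP[a aC sa]]] _ st tv.
    have := comp_adj sC st; rewrite inE => /orP[tU|tC]; last by rewrite inE tC.
    by apply: (SU t s) => //; rewrite adj_sym.
  have [w ms] := mate_exists sU.
  have [s1 s2 zs zw' [b bC wb]] := far s w a ms aC sa.
  have [tU|tU] := boolP (t \in U); last first.
    have tH : t \in H by rewrite in_rest tU.
    rewrite inE; apply/orP; left; apply: mem_comp => //.
    apply: connect_trans (comp_linked bC) _; rewrite linked_sym.
    exact: mates_linked ms st wb tH (comp_rest bC).
  have [tw|tw] := eqVneq t w; first by apply: (SU t b) => //; rewrite tw.
  have ts : t != s by rewrite eq_sym adj_neq.
  have [t' mt] := mate_exists tU.
  have [t's t'w] := mate_disjoint ms mt ts tw.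
  (* It remains to treat a neighbour t of s in [U] on another edge tt' of [M]. If t' is attached to
     the component of c, so is t; if to another one, [mates_not_adj] forbids the edge st. *)
  have [/exists_inP[h hH t'h]|/exists_inPn nt'] := boolP [exists h in H, adj t' h].
    have [ch|nch] := boolP (linked c h).
      have hC := mem_comp hH ch.
      have [_ _ _ _ [a' a'C ta']] := far t' t h (mate_sym mt) hC t'h.
      exact: (SU t a').
    have nbh : ~~ linked b h.
      by apply: contra nch; apply: connect_trans (comp_linked bC).
    have := mates_not_adj (mate_sym ms) (mate_sym mt) t'w t's wb t'h
      (comp_rest bC) hH nbh.
    by rewrite st.
  exfalso.
  have t'z2 : t' != z2 by apply: contraTneq z2d => <-; apply: nt'.
  have t'w2 : t' != w2 by apply: contraTneq w2b2 => <-; apply: nt'.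
  have [tz2 tw2] := mate_disjoint m2 (mate_sym mt) t'z2 t'w2.
  have [ws ww'] := mate_disjoint ms m2 zs zw'.
  (* With t' attached to nothing, z2w2 serves as the third edge of the exchange, its end adjacent to
     v being matched with v. *)
  have [vz|vw] := orP (mate_adj_v m2).
    apply: (@no_edge_to_unattached s w t t' z2 w2 b b2) => //; rewrite 1?eq_sym //.
    + exact: comp_rest bC.
    + exact: sep.
  apply: (@no_edge_to_unattached s w t t' w2 z2 b d) => //; rewrite 1?eq_sym //.
  + exact: mate_sym.
  + exact: comp_rest bC.
  + exact: sep.
- by rewrite inE comp_refl.
- exact: rest_neq_v.
Qed.

(** Distinct x and y are either mates, excluded by [mates_linked], or on different edges of [M],
    excluded by [no_two_attached_edges]. *)
Lemma attached_unique x y c d : x \in U -> y \in U -> adj x c -> adj y d ->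
  c \in H -> d \in H -> ~~ linked c d -> x = y.
Proof.
move=> xU yU xc yd cH dH ncd; apply/eqP; apply: contraT => xy.
have [x' mx] := mate_exists xU; have [y' my] := mate_exists yU.
have [yx'|yx'] := eqVneq y x'.
  by case/negP: ncd; apply: mates_linked mx xc _ cH dH; rewrite -yx'.
case: (no_two_attached_edges mx my _ yx' xc yd cH dH ncd).
by rewrite eq_sym.
Qed.

(** Otherwise v would separate c from d. *)
Lemma comp_attached c d : c \in H -> d \in H -> ~~ linked c d ->
  exists2 x, x \in U & exists2 a, a \in comp c & adj x a.
Proof.
move=> cH dH ncd.
suff /exists_inP[x xU /exists_inP[a aC xa]] :
    [exists x in U, exists a in comp c, adj x a].
  by exists x => //; exists a.
apply: contraT => nx.
case/negP: (unlinked_notin_comp ncd).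
apply: (@closed_minus_vertex _ v (comp c) c) => //; try exact: rest_neq_v.
  exact: comp_refl.
move=> s t sC _ st _; have := comp_adj sC st; rewrite inE => /orP[tU|//].
case/negP: nx; apply/exists_inP; exists t => //; apply/exists_inP; exists s => //.
by rewrite adj_sym.
Qed.

(** Let x in [U] be attached to the component of d. By [attached_unique] no other vertex of [U] is
    attached to that of c, so x would separate c from d. *)
Lemma rest_linked c d : c \in H -> d \in H -> linked c d.
Proof.
move=> cH dH; apply: contraT => ncd.
have ndc : ~~ linked d c by rewrite linked_sym.
have [x xU [a aC xa]] := comp_attached dH cH ndc.
case/negP: (unlinked_notin_comp ncd).
apply: (@closed_minus_vertex _ x (comp c) c) => //.
- exact: comp_refl.
- by rewrite eq_sym U_neq_rest.
- move=> s t sC _ st tx; have := comp_adj sC st; rewrite inE => /orP[tU|//].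
  case/eqP: tx; apply: (@attached_unique t x s a) => //.
  + by rewrite adj_sym.
  + exact: comp_rest sC.
  + exact: comp_rest aC.
  apply: contra ncd => sa; apply: connect_trans (comp_linked sC) _.
  by apply: connect_trans sa _; rewrite linked_sym comp_linked.
- by rewrite eq_sym U_neq_rest.
Qed.

(** * The rest as a connected, randomly matchable graph *)

Lemma rest_connected : connected (del_vertices (U :|: [set v])).
Proof.
move=> x y.
pose S := [set val z | z in connect (@adj (del_vertices (U :|: [set v]))) x].
have : val y \in S.
  rewrite -(@closed_connect _ rest_adj S _ (val x)).
  - by apply: imset_f; apply: connect0.
  - apply: intro_closed; first exact: linked_sym.
    move=> a b /and3P[ab aH bH] /imsetP[z zx az].
    apply/imsetP; exists (Sub b bH) => //.
    apply: connect_trans zx (connect1 _).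
    by rewrite /= /induced_adj /= -az.
  - exact: rest_linked (valP x) (valP y).
by case/imsetP=> z zx /val_inj ->.
Qed.

(** If [N] missed u, then with [U] and [cover N] covered both u and v would be isolated, giving two
    odd closed singletons. *)
Lemma rest_randomly_matchable (N : {set {set del_vertices (U :|: [set v])}}) :
  maxset (@matching _) N -> cover N = setT.
Proof.
move=> mN; apply/setP=> u; rewrite inE; apply: contraT => uN; exfalso.
have uH := valP u; have := uH; rewrite in_rest => /andP[uU uv].
have uN' : val u \notin val @: cover N by rewrite mem_imset //; apply: val_inj.
have vN' : v \notin val @: cover N.
  by apply/negP=> /imsetP[z _ vz]; have := rest_neq_v (valP z); rewrite -vz eqxx.
have mW : matchable (U :|: val @: cover N).
  apply: matchable_disjointU.
  - apply/pred0P=> x /=; apply/negP=> /andP[xU /imsetP[z _ xz]].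
    by have := U_neq_rest (valP z) xU; rewrite xz eqxx.
  - exact: matchable_cover.
  - by apply/lift_matchable/matchable_cover/maxsetp.
apply: (@no_two_odd_closed _ hfc heq _ [set v] [set val u] mW);
  rewrite ?cards1 ?disjoints1 ?in_setU ?negb_or ?vU ?uU ?in_set1 //.
- by rewrite eq_sym.
- by move=> s t /set1P -> /isolated_neighbor tU; rewrite !in_setU tU.
- move=> s t /set1P -> ut; rewrite !in_setU.
  have [//|tU] := boolP (t \in U).
  have tv : t != v by apply: contraTneq ut => ->; apply: rest_not_adj_v uH.
  have tH : t \in H by rewrite in_rest tU.
  suff : Sub t tH \in cover N by move/(imset_f val) => /= ->.
  by apply: (maximal_matching_neighbor mN uN).
Qed.

End IsolatingMatching.

Theorem theorem5 (G : sgraph) (hconn : k_connected 2 G)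
    (hfc : factor_critical G) (heq : equimatchable G)
    (v : G) (Mv : {set {set G}}) (hMv : minimal_isolating_matching Mv v) :
  exists n : nat,
    isomorphic (del_vertices (cover Mv :|: [set v])) (complete_graph (2 * n)) \/
    isomorphic (del_vertices (cover Mv :|: [set v])) (complete_bipartite n n).
Proof.
apply: randomly_matchable_classification.
  exact: rest_connected hconn hfc heq v Mv hMv.
exact: rest_randomly_matchable hfc heq v Mv hMv.
Qed.
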